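(* Let $A\in\mathbb{R}^{m\times n}$ be an $s$-regular matrix and $b\in\mathbb{R}^m$, and let all M-stationary points of $\mathrm{SR}(A,b)$ be nondegenerate with pairwise different values of the objective function $f$. Then $$(n-s)\,r_1\ge r-1,$$ where $r$ is the number of local minimizers of $\mathrm{SR}(A,b)$, and $r_1$ is the number of saddle points of $\mathrm{SR}(A,b)$.
   Context: Fix integers $m,n$ and $s\in\{0,1,\ldots,n-1\}$ with $s\le m$ (standing assumption). For $x\in\mathbb{R}^n$, $\|x\|_0$ is the number of non-zero entries of $x$, and $\mathbb{R}^{n,s}=\{x\in\mathbb{R}^n : \|x\|_0\le s\}$. For $(A,b)\in\mathbb{R}^{m\times n}\times\mathbb{R}^m$, the sparse recovery problem $\mathrm{SR}(A,b)$ is to minimize $f(x)=\frac12\|Ax-b\|_2^2$ subject to $x\in\mathbb{R}^{n,s}$. A local minimizer is a local minimizer of $f$ restricted to $\mathbb{R}^{n,s}$. For $x\in\mathbb{R}^{n,s}$ put $I_0(x)=\{i : x_i=0\}$ and $I_1(x)=\{j : x_j\neq 0\}$. For an index set $I\subset\{1,\ldots,n\}$, $A_I$ is the submatrix of $A$ formed by the columns with index in $I$, $A_I^T$ is its transpose, and $x_I$ is the subvector of $x$ with entries indexed by $I$ (terms with empty index set are zero, conditions on an empty index set are vacuous). The matrix $A$ is called $s$-regular if $\mathrm{rank}(A_I)=s$ for every $I\subset\{1,\ldots,n\}$ with $|I|=s$. A point $\bar x\in\mathbb{R}^{n,s}$ is called M-stationary for $\mathrm{SR}(A,b)$ if $A_{I_1(\bar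 x)}^TA_{I_1(\bar x)}\bar x_{I_1(\bar x)}-A_{I_1(\bar x)}^Tb=0$. An M-stationary point $\bar x$ is called nondegenerate if both of the following hold: (ND1) if $\|\bar x\|_0<s$, then all entries of the vector $A_{I_0(\bar x)}^TA_{I_1(\bar x)}\bar x_{I_1(\bar x)}-A_{I_0(\bar x)}^Tb$ are non-zero; (ND2) $\mathrm{rank}(A_{I_1(\bar x)})=\|\bar x\|_0$. A saddle point of $\mathrm{SR}(A,b)$ is an M-stationary point $\bar x$ with exactly $s-1$ non-zero entries, i.e. $\|\bar x\|_0=s-1$. *)

(* Defs.v *)
From mathcomp Require Import all_boot all_order all_algebra.
From mathcomp Require Import all_classical all_reals all_analysis.

Set Implicit Arguments.
Unset Strict Implicit.
Unset Printing Implicit Defensive.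

Import Order.TTheory GRing.Theory Num.Theory.
Import numFieldNormedType.Exports.

Local Open Scope classical_set_scope.
Local Open Scope ring_scope.

Section SparseRecovery.
Variables (R : realType) (m n : nat).
Implicit Types (A : 'M[R]_(m, n)) (b : 'cV[R]_m) (x y : 'cV[R]_n).
Implicit Types (I : {set 'I_n}) (s : nat).

Definition zeros x : {set 'I_n} := [set i | x i ord0 == 0]%SET.

Definition nonzeros x : {set 'I_n} := [set i | x i ord0 != 0]%SET.

Definition norm0 x : nat := #|nonzeros x|.

Definition sparse_set s : set 'cV[R]_n := [set x | (norm0 x <= s)%N].

Definition columns I A : 'M[R]_(m, #|I|) := colsub (@enum_val _ (mem I)) A.

Definition entries I x : 'cV[R]_#|I| := rowsub (@enum_val _ (mem I)) x.

Definition normsq2 (k : nat) (z : 'cV[R]_k) : R := \sum_i z i ord0 ^+ 2.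

Definition objective A b x : R := 2^-1 * normsq2 (A *m x - b).

(* The neighbourhoods of x are those of the product topology on the entries,
   i.e. the usual topology of R^n. *)
Definition local_minimizer s A b x : Prop :=
  sparse_set s x /\
  \forall y \near within (sparse_set s) (nbhs x), objective A b x <= objective A b y.

Definition s_regular s A : Prop :=
  forall I, #|I| = s -> \rank (columns I A) = s.

(* The subvector, indexed by I, of the gradient of the objective at x:
   A *m x = columns (nonzeros x) A *m entries (nonzeros x) x. *)
Definition gradient_entries I A b x : 'cV[R]_#|I| :=
  (columns I A)^T *m columns (nonzeros x) A *m entries (nonzeros x) x
  - (columns I A)^T *m b.

Definition M_stationary s A b x : Prop :=
  sparse_set s x /\ gradient_entries (nonzeros x) A b x = 0.

Definition ND1 s A b x : Prop :=
  (norm0 x < s)%N ->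
  forall i : 'I_#|zeros x|, gradient_entries (zeros x) A b x i ord0 != 0.

Definition ND2 A x : Prop :=
  \rank (columns (nonzeros x) A) = norm0 x.

Definition nondegenerate_point s A b x : Prop := ND1 s A b x /\ ND2 A x.

(* "(norm0 x).+1 = s" rather than "norm0 x = s.-1": for s = 0 there is no
   saddle point. *)
Definition saddle_point s A b x : Prop :=
  M_stationary s A b x /\ (norm0 x).+1 = s.

End SparseRecovery.

(* Main.v *)
Require Import Defs.
From mathcomp Require Import all_boot all_order all_algebra.
From mathcomp Require Import finmap.
From mathcomp Require Import all_classical all_reals all_analysis.
From mathcomp Require Import ring lra zify.

(** Regularity and (ND1) determine both counts: there are at most 'C(n, s)
local minimizers and, when s > 0, at least 'C(n, s - 1) saddle points, so that
the inequality becomes one between binomial coefficients (bin_le_pred).  When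
s = 0 there is at most one local minimizer.

By s-regularity, for every set I of at most s indices the objective has a
unique critical point x_I among the vectors supported in I, the solution of the
normal equations for the columns in I (restricted_minimizerP).  A stationary
point is x_I for its own support I, hence is determined by it.

The support of x_I is all of I (restricted_minimizer_full).  Were it smaller,
x_I would be a stationary point with fewer than s nonzero entries, so (ND1)
would make the gradient nonzero at every vanishing coordinate; but the gradient
of x_I vanishes on I.  So each I with s - 1 elements yields its own saddle
point.

A local minimizer with fewer than s nonzero entries may be moved a little along
any coordinate axis without leaving the sparse set, so its whole gradient
vanishes, again against (ND1), because s < n leaves a vanishing coordinate.  So
local minimizers have exactly s nonzero entries (local_minimizer_norm0) and
each is given by its support. *)

Set Implicit Arguments.
Unset Strict Implicit.
Unset Printing Implicit Defensive.

Import Order.TTheory GRing.Theory Num.Theory.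
Import numFieldNormedType.Exports.

Local Open Scope classical_set_scope.
Local Open Scope ring_scope.

(** * Finite sets and binomial coefficients *)

Lemma superset_card (T : finType) (I : {set T}) (s : nat) :
  (#|I| <= s <= #|T|)%N -> exists2 J : {set T}, I \subset J & #|J| = s.
Proof.
case/andP; elim: s => [|s IHs] leIs lesT.
  by exists I => //; apply/eqP; rewrite -leqn0.
move: leIs; rewrite leq_eqVlt => /orP[/eqP <-|leIs]; first by exists I.
have [J IJ cardJ] := IHs leIs (ltnW lesT).
have /set0Pn[i] : ~: J != finset.set0.
  by rewrite -card_gt0 cardsCs finset.setCK cardJ subn_gt0.
rewrite finset.inE => iJ; exists (i |: J)%SET.
  by rewrite (fintype.subset_trans IJ) ?finset.subsetUr.
by rewrite cardsU1 iJ cardJ.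
Qed.

Section FiniteImage.
Variables (T : finType) (U : choiceType) (f : T -> U) (D : {set T}).
Variable S : set U.

Lemma finite_set_sub_image : S `<=` f @` [set` D] -> finite_set S.
Proof. by move=> /sub_finite_set; apply; apply: finite_image. Qed.

Lemma card_fset_set_le_image :
  S `<=` f @` [set` D] -> (#|` fset_set S|%fset <= #|D|)%N.
Proof.
move=> SfD; have finS := finite_set_sub_image SfD.
rewrite cardE -(size_map f); apply: uniq_leq_size => // y.
rewrite in_fset_set // inE => /SfD[x /= Dx <-].
by apply: map_f; rewrite mem_enum.
Qed.

Lemma card_fset_set_ge_image : finite_set S -> {in D &, injective f} ->
  {in D, forall x, S (f x)} -> (#|D| <= #|` fset_set S|%fset)%N.
Proof.
move=> finS injf fDS; rewrite cardE -(size_map f); apply: uniq_leq_size.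
  rewrite map_inj_in_uniq ?enum_uniq // => x y.
  by rewrite !mem_enum; apply: injf.
move=> y /mapP[x]; rewrite mem_enum => Dx ->.
by rewrite in_fset_set // inE; apply: fDS.
Qed.

End FiniteImage.

(** Since (k + 1) 'C(n, k + 1) = (n - k) 'C(n, k), the case k > 0 follows from
n - k <= (k + 1) (n - k - 1), even without the added 1; for k = 0 the bound is
an equality. *)
Lemma bin_le_pred (n k : nat) : (k.+1 < n)%N ->
  ('C(n, k.+1) <= (n - k.+1) * 'C(n, k) + 1)%N.
Proof.
case: k => [|k] ltkn; first by rewrite bin1 bin0; lia.
suff: (k.+2 * 'C(n, k.+2) <= k.+2 * ((n - k.+2) * 'C(n, k.+1)))%N.
  by rewrite leq_pmul2l // => /leq_trans; apply; rewrite leq_addr.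
rewrite mul_bin_left mulnA leq_mul2r; apply/orP; right; nia.
Qed.

(** * The gradient of the objective *)

Section LeastSquares.
Variables (R : realType) (m n : nat).
Implicit Types (A : 'M[R]_(m, n)) (b : 'cV[R]_m) (x y z : 'cV[R]_n).
Implicit Types (I : {set 'I_n}).

Lemma normsq2E k (z : 'cV[R]_k) : normsq2 z = (z^T *m z) 0 0.
Proof. by rewrite mxE; apply: eq_bigr => i _; rewrite mxE expr2. Qed.

Lemma normsq2_eq0 k (z : 'cV[R]_k) : normsq2 z = 0 -> z = 0.
Proof.
move=> z0; apply/colP => i; rewrite mxE.
have /psumr_eq0P : forall i, true -> 0 <= z i ord0 ^+ 2 by move=> *; exact: sqr_ge0.
by move=> /(_ z0 i isT)/eqP; rewrite sqrf_eq0 => /eqP.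
Qed.

Definition gradient A b x : 'cV[R]_n := A^T *m (A *m x - b).

Lemma nonzeros_subP I x :
  reflect (forall i, i \notin I -> x i 0 = 0) (nonzeros x \subset I).
Proof.
apply: (iffP fintype.subsetP) => [xI i iI | xI i].
  by apply/eqP/(contraNT _ iI) => xi; apply: xI; rewrite finset.inE.
by rewrite finset.inE => xi; apply/(contraNT _ xi) => /xI ->.
Qed.

Lemma mul_columns_entries I A x :
  nonzeros x \subset I -> columns I A *m entries I x = A *m x.
Proof.
move=> /nonzeros_subP xI; apply/colP => k; rewrite !mxE.
rewrite (bigID (mem I)) /= [X in _ + X]big1 => [|i /xI ->]; last by rewrite mulr0.
by rewrite addr0 [RHS]big_enum_val /=; apply: eq_bigr => i _; rewrite !mxE.
Qed.

Lemma gradient_entriesE I A b x :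
  gradient_entries I A b x = entries I (gradient A b x).
Proof.
rewrite /gradient_entries -mulmxA mul_columns_entries // -mulmxBr.
by rewrite /columns trmx_mxsub mul_rowsub_mx.
Qed.

Lemma M_stationaryP s A b x :
  M_stationary s A b x <->
  (norm0 x <= s)%N /\ {in nonzeros x, forall i, gradient A b x i 0 = 0}.
Proof.
rewrite /M_stationary gradient_entriesE; split=> -[xs gx]; split=> //.
  move=> i xi; have /colP/(_ (enum_rank_in xi i)) := gx.
  by rewrite !mxE enum_rankK_in.
by apply/colP => k; rewrite mxE [RHS]mxE gx // enum_valP.
Qed.

Lemma ND1_gradient s A b x : ND1 s A b x -> (norm0 x < s)%N ->
  forall i, x i 0 = 0 -> gradient A b x i 0 != 0.
Proof.
move=> nd xs i xi; have zi : i \in zeros x by rewrite finset.inE xi.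
have := nd xs (enum_rank_in zi i).
by rewrite gradient_entriesE mxE enum_rankK_in.
Qed.

Lemma objective_line A b x z (t : R) :
  objective A b (x + t *: z) =
  objective A b x + t * (z^T *m gradient A b x) 0 0
  + t ^+ 2 * (2^-1 * normsq2 (A *m z)).
Proof.
rewrite /objective mulmxDr -scalemxAr addrAC /gradient mulmxA -trmx_mul.
rewrite /normsq2 !mxE !mulr_sumr -!big_split /=; apply: eq_bigr => i _.
by rewrite !mxE; field.
Qed.

Lemma quadratic_local_min (g c e : R) : 0 < e ->
  (forall t, `|t| < e -> 0 <= t * g + t ^+ 2 * c) -> g = 0.
Proof.
move=> e0 tmin; apply/eqP/negPn/negP => g0.
have g_gt0 : 0 < `|g| by rewrite normr_gt0.
(* The point t = - d g has the value d g^2 (d c - 1), which is negative once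
   d c < 1; the first bound keeps t within e, the second ensures d c < 1. *)
set d : R := Num.min (e / (2 * `|g|)) (2 * (`|c| + 1))^-1.
have c_gt0 : 0 < 2 * (`|c| + 1) by have := normr_ge0 c; lra.
have d0 : 0 < d by rewrite lt_min invr_gt0 c_gt0 divr_gt0 // mulr_gt0.
have de : d * `|g| < e.
  have : d <= e / (2 * `|g|) by rewrite ge_min lexx.
  by rewrite ler_pdivlMr ?mulr_gt0 //; lra.
have dc : d * c < 1.
  have : d <= (2 * (`|c| + 1))^-1 by rewrite ge_min lexx orbT.
  rewrite -[_^-1]mul1r ler_pdivlMr //.
  by have := ler_wpM2l (ltW d0) (ler_norm c); lra.
have := tmin (- (d * g)); rewrite normrN normrM (gtr0_norm d0) => /(_ de).
have -> : - (d * g) * g + (- (d * g)) ^+ 2 * c = d * g ^+ 2 * (d * c - 1) by ring.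
rewrite leNgt => /negP; apply.
by rewrite pmulr_rlt0 ?subr_lt0 // mulr_gt0 // exprn_even_gt0.
Qed.

(** The segment through x in the direction of the i-th axis stays in the sparse
set as long as adding i to the support keeps it of size at most s, and the
objective is quadratic along it. *)
Lemma local_minimizer_gradient s A b x i :
  local_minimizer s A b x -> (#|i |: nonzeros x| <= s)%N ->
  gradient A b x i 0 = 0.
Proof.
move=> [_ /nbhs_ballP[e /= e0 xmin]] xis.
apply: (@quadratic_local_min _ (2^-1 * normsq2 (A *m delta_mx i 0)) e e0).
move=> t te; have := objective_line A b x (delta_mx i 0) t.
rewrite trmx_delta -rowE mxE -addrA => objE.
rewrite -(lerD2l (objective A b x)) addr0 -objE; apply: xmin.
  split=> // j k; rewrite /ball /= !mxE opprD addNKr normrN normrM.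
  by apply: le_lt_trans te; rewrite ler_piMr ?normr_nat ?lern1 ?leq_b1.
apply: leq_trans xis; apply/subset_leq_card/nonzeros_subP => j.
rewrite !finset.inE !negb_or negbK => /andP[/negPf ji /eqP xj].
by rewrite !mxE xj ji mulr0 addr0.
Qed.

(** * Critical points on a coordinate subspace *)

(** Independence of any s columns passes to fewer columns by enlarging I to a
set of exactly s indices, which is where s <= n enters. *)
Lemma s_regular_inj s A I z : (s <= n)%N -> s_regular s A -> (#|I| <= s)%N ->
  nonzeros z \subset I -> A *m z = 0 -> z = 0.
Proof.
move=> sn regA Is zI Az.
have [|J IJ cardJ] := @superset_card _ I s; first by rewrite Is card_ord.
have zJ := fintype.subset_trans zI IJ.
have freeJ : row_free (columns J A)^T.
  by rewrite /row_free mxrank_tr regA // cardJ.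
have eJ0 : entries J z = 0.
  apply: trmx_inj; apply: (row_free_inj freeJ) => /=.
  by rewrite -trmx_mul mul_columns_entries // Az !trmx0 mul0mx.
apply/colP => i; rewrite mxE.
have [iJ|iJ] := boolP (i \in J); last exact: (nonzeros_subP _ _ zJ).
by have /colP/(_ (enum_rank_in iJ i)) := eJ0; rewrite !mxE enum_rankK_in.
Qed.

(** The coordinate projection onto the vectors supported in I. *)
Definition restriction I : 'M[R]_n := diag_mx (\row_i (i \in I)%:R).

Lemma mul_restriction I x i : (restriction I *m x) i 0 = (i \in I)%:R * x i 0.
Proof. by rewrite /restriction mul_diag_mx !mxE. Qed.

(** The system normal_matrix A I *m x = restriction I *m (A^T *m b) consists of
the normal equations at the indices in I and of x i = 0 at the others, so that
the normal equations for the columns in I become a square system of the fixed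
size n. *)
Definition normal_matrix A I : 'M[R]_n :=
  restriction I *m (A^T *m A) + (1%:M - restriction I).

Lemma mul_normal_matrix A I x i :
  (normal_matrix A I *m x) i 0 =
  if i \in I then (A^T *m (A *m x)) i 0 else x i 0.
Proof.
rewrite mulmxDl mulmxBl mul1mx -!mulmxA mxE [X in _ + X]mxE [X in _ + (_ + X)]mxE.
rewrite !mul_restriction.
by case: ifP => _; rewrite ?mul1r ?mul0r ?subrr ?addr0 ?add0r ?subr0.
Qed.

Definition restricted_minimizer A b I : 'cV[R]_n :=
  invmx (normal_matrix A I) *m (restriction I *m (A^T *m b)).

Section Regular.
Variables (s : nat) (A : 'M[R]_(m, n)) (b : 'cV[R]_m).
Hypotheses (ltsn : (s < n)%N) (regA : s_regular s A).

(** A vector z in the kernel vanishes off I while A^T A z vanishes on I, so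
z^T A^T A z = 0; hence A z = 0, and regularity gives z = 0. *)
Lemma normal_matrix_unit I : (#|I| <= s)%N -> normal_matrix A I \in unitmx.
Proof.
move=> Is; rewrite -unitmx_tr -row_free_unit.
apply/inj_row_free => v.
move=> /(congr1 trmx); rewrite trmx_mul trmxK trmx0.
move: (v^T) (trmxK v) => z <- /colP Nz0; suff -> : z = 0 by rewrite trmx0.
have zI : nonzeros z \subset I.
  apply/nonzeros_subP => i iI.
  by have := Nz0 i; rewrite mul_normal_matrix (negPf iI) mxE.
apply: (s_regular_inj (ltnW ltsn) regA Is zI); apply: normsq2_eq0.
rewrite normsq2E trmx_mul -mulmxA mxE big1 // => i _; rewrite mxE.
have [iI|iI] := boolP (i \in I).
  by have := Nz0 i; rewrite mul_normal_matrix iI => ->; rewrite mxE mulr0.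
by rewrite (nonzeros_subP _ _ zI) // mul0r.
Qed.

Lemma restricted_minimizerP I x : (#|I| <= s)%N ->
  x = restricted_minimizer A b I <->
  (nonzeros x \subset I /\ {in I, forall i, gradient A b x i 0 = 0}).
Proof.
move=> Is; have unitN := normal_matrix_unit Is.
have -> : (x = restricted_minimizer A b I) <->
    (normal_matrix A I *m x = restriction I *m (A^T *m b)).
  rewrite /restricted_minimizer.
  by split=> [->|<-]; rewrite ?mulKVmx ?mulKmx.
have gE i : gradient A b x i 0 = (A^T *m (A *m x)) i 0 - (A^T *m b) i 0.
  by rewrite /gradient mulmxBr !mxE.
split=> [/colP Nx|[/nonzeros_subP xI gx]].
  split=> [|i iI]; [apply/nonzeros_subP => i iI|];
    have := Nx i; rewrite mul_normal_matrix mul_restriction.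
    by rewrite (negPf iI) mul0r.
  by rewrite iI mul1r gE => ->; rewrite subrr.
apply/colP => i; rewrite mul_normal_matrix mul_restriction.
case: ifPn => [iI|/xI ->]; last by rewrite mul0r.
by rewrite mul1r; apply/eqP; rewrite -subr_eq0 -gE gx.
Qed.

Lemma M_stationary_restricted_minimizer x :
  M_stationary s A b x -> x = restricted_minimizer A b (nonzeros x).
Proof. by move=> /M_stationaryP[xs gx]; apply/restricted_minimizerP. Qed.

Hypothesis ndA : forall x, M_stationary s A b x -> nondegenerate_point s A b x.

(** If some i in I were missing from the support, the point would have fewer than
s nonzero entries, and (ND1) would contradict its vanishing gradient at i. *)
Lemma restricted_minimizer_full I : (#|I| <= s)%N ->
  M_stationary s A b (restricted_minimizer A b I) /\
  nonzeros (restricted_minimizer A b I) = I.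
Proof.
move=> Is; set x := restricted_minimizer A b I.
have [xI gx] := (restricted_minimizerP x Is).1 erefl.
have stx : M_stationary s A b x.
  apply/M_stationaryP; split; first exact: leq_trans (subset_leq_card xI) Is.
  by move=> i /(fintype.subsetP xI); apply: gx.
split=> //; apply/eqP; rewrite finset.eqEsubset xI /=; apply/fintype.subsetP => i iI.
rewrite finset.inE; apply/negP => /eqP xi.
have xs : (norm0 x < s)%N.
  apply: leq_trans Is; apply/proper_card; rewrite properE xI /=.
  by apply/negP => /fintype.subsetP/(_ i iI); rewrite finset.inE xi eqxx.
by have := ND1_gradient (ndA stx).1 xs xi; rewrite gx ?eqxx.
Qed.

(** With fewer than s nonzero entries every axis is an admissible direction, so
the gradient vanishes also at a zero entry, which exists because s < n; this
is excluded by (ND1). *)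
Lemma local_minimizer_norm0 x : local_minimizer s A b x ->
  M_stationary s A b x /\ norm0 x = s.
Proof.
move=> minx; have xs : (norm0 x <= s)%N := minx.1.
have stx : M_stationary s A b x.
  apply/M_stationaryP; split=> // i xi.
  apply: (local_minimizer_gradient minx).
  by rewrite (finset.setUidPr _) ?finset.sub1set.
split=> //; apply/eqP; rewrite eqn_leq xs leqNgt; apply/negP => ltxs.
have /set0Pn[i] : ~: nonzeros x != finset.set0.
  rewrite -card_gt0 cardsCs finset.setCK subn_gt0 card_ord.
  exact: leq_ltn_trans ltsn.
rewrite !finset.inE negbK => /eqP xi.
have := ND1_gradient (ndA stx).1 ltxs xi.
rewrite (local_minimizer_gradient minx) ?eqxx //.
by rewrite cardsU1 finset.inE xi eqxx.
Qed.

End Regular.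
End LeastSquares.

(** * Counting local minimizers and saddle points *)

Theorem theorem6 (R : realType) (m n s : nat)
    (A : 'M[R]_(m, n)) (b : 'cV[R]_m) :
  (s < n)%N -> (s <= m)%N ->
  s_regular s A ->
  (forall x, M_stationary s A b x -> nondegenerate_point s A b x) ->
  (forall x y, M_stationary s A b x -> M_stationary s A b y ->
     x <> y -> objective A b x <> objective A b y) ->
  [/\ finite_set [set x | local_minimizer s A b x],
      finite_set [set x | saddle_point s A b x] &
      let r := #|` fset_set [set x | local_minimizer s A b x]|%fset in
      let r1 := #|` fset_set [set x | saddle_point s A b x]|%fset in
      ((n%:Z - s%:Z) * r1%:Z >= r%:Z - 1)%R].
Proof.
move=> ltsn _ regA ndA _.
set rm := restricted_minimizer A b.
have stE x : M_stationary s A b x -> x = rm (nonzeros x).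
  exact: M_stationary_restricted_minimizer.
set D := fun k : nat => [set I : {set 'I_n} | #|I| == k]%SET.
have cardD k : #|D k| = 'C(n, k) by rewrite card_draws card_ord.
have minD : [set x | local_minimizer s A b x] `<=` rm @` [set` D s].
  move=> x /(local_minimizer_norm0 ltsn ndA)[/stE xE xs].
  by exists (nonzeros x) => //=; rewrite finset.inE; apply/eqP.
have saddleD : [set x | saddle_point s A b x] `<=` rm @` [set` D s.-1].
  move=> x [/stE xE xs]; exists (nonzeros x) => //=.
  by rewrite finset.inE -xs.
have finS := finite_set_sub_image saddleD.
split=> //; first exact: finite_set_sub_image minD.
set r := #|` _|%fset; set r1 := #|` _|%fset => /=.
have r_le : (r <= 'C(n, s))%N.
  by rewrite -cardD; apply: card_fset_set_le_image minD.
have [s0|[k sE]] : s = 0%N \/ exists k, s = k.+1.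
  by case: (s) => [|k]; [left | right; exists k].
  by move: r_le; rewrite s0 bin0; nia.
have r1_ge : ('C(n, k) <= r1)%N.
  have full I : I \in D k ->
      M_stationary s A b (rm I) /\ nonzeros (rm I) = I.
    rewrite finset.inE => /eqP Ik.
    by apply: restricted_minimizer_full; rewrite // Ik sE.
  rewrite -cardD; apply: (card_fset_set_ge_image (f := rm) finS).
    by move=> I J /full[_ suppI] /full[_ suppJ] eqIJ; rewrite -suppI eqIJ suppJ.
  move=> I ID; have [stI suppI] := full I ID; split=> //.
  by rewrite /norm0 suppI sE; move: ID; rewrite finset.inE => /eqP ->.
have := @bin_le_pred n k; rewrite -sE => /(_ ltsn) bin_le.
have : (r <= (n - s) * r1 + 1)%N.
  apply: leq_trans r_le (leq_trans bin_le _).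
  by rewrite leq_add2r leq_mul2l r1_ge orbT.
nia.
Qed.
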